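(* Let $t\ge2$ and $s\ge2$ be integers. Suppose there exist $\vartheta>0$ and $N>0$ such that $\mathbf{R}(t,n)\le\frac{\mathbf{R}(t+1,n)}{n^{\vartheta}}$ for every $n>N$, and suppose that $K_s$ has a phase transition from $\mathbf{Q}(t,n)$ to $\mathbf{Q}(t+1,n)$. Then there exists $\varepsilon>0$ such that for every function $\omega$ with $\omega(n)\to\infty$ slowly, i.e. with $\omega(n)\to\infty$ and $\omega(n)=o(\log\log\log n)$, setting $\varphi_\varepsilon(n)=2^{-\omega(n)(\log n)^{1-\varepsilon}}$, the following hold: (i) $K_s$ has a $\varphi_\varepsilon$-phase-transition at $\mathbf{Q}(t,n)$, i.e. a weak phase transition at $\mathbf{Q}(t,n)$; (ii) $K_s$ does not have a phase transition from $\varphi_\varepsilon(n)\mathbf{Q}(t,n)$ to $\mathbf{Q}(t+1,n)$.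
   Context: All graphs are simple and logarithms are base $2$. For integers $t\ge2$: $\mathbf{R}(t,m)$ is the Ramsey number, the minimum $n$ such that every graph on $n$ vertices contains a $K_t$ or an independent set of size $m$; $\mathbf{Q}(t,n)$ is the minimum independence number over all $K_t$-free graphs on $n$ vertices. For a graph $H$ and a function $f$, $\mathbf{RT}(n,H,f(n))$ denotes the maximum number of edges of an $H$-free graph on $n$ vertices with independence number less than $f(n)$ (taken to be $0$ if no such graph exists). Set $\overline{\rho\tau}(H,f)=\limsup_{n\to\infty}\mathbf{RT}(n,H,f(n))/n^2$ and $\underline{\rho\tau}(H,f)=\liminf_{n\to\infty}\mathbf{RT}(n,H,f(n))/n^2$. Phase transitions: given a graph $H$ and functions $g(n)\le f(n)$ (for all large $n$), $H$ has a phase transition from $f$ to $g$ if $\overline{\rho\tau}(H,g)<\underline{\rho\tau}(H,f)$. Given a function $\varphi(n)\to0$, $H$ has a $\varphi$-phase-transition at $f$ if $H$ has a phase transition from $f$ to $\varphi f$. $H$ has a weak phase transition at $f$ if there exists $\varepsilon'>0$ such that $H$ has a $\varphi$-phase-transition at $f$ for $\varphi(n)=2^{-(\log n)^{1-\varepsilon'}}$. *)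

(* Defs.v *)
From mathcomp Require Import all_boot all_order all_algebra.
From mathcomp Require Import all_classical all_reals all_analysis.

Set Implicit Arguments.
Unset Strict Implicit.
Unset Printing Implicit Defensive.

Import Order.TTheory GRing.Theory Num.Theory.
Import numFieldNormedType.Exports.

Local Open Scope classical_set_scope.
Local Open Scope ring_scope.

Section Graphs.
Local Open Scope nat_scope.

(* A simple graph is given by its edges, which are two-element sets of
   vertices. *)
Definition graph (V : finType) : Type :=
  {E : {set {set V}} | [forall e in E, #|e| == 2]}.

Definition edges (V : finType) (G : graph V) : {set {set V}} := val G.

Definition adj (V : finType) (G : graph V) : rel V :=
  fun x y => [set x; y]%SET \in edges G.

(* [G] has a (not necessarily induced) subgraph isomorphic to [H]. *)
Definition contains (V W : finType) (G : graph V) (H : graph W) : bool :=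
  [exists h : {ffun W -> V}, injectiveb h &&
     [forall x, forall y, adj H x y ==> adj G (h x) (h y)]].

Definition independent (V : finType) (G : graph V) (S : {set V}) : bool :=
  [forall x in S, forall y in S, ~~ adj G x y].

Definition indep_num (V : finType) (G : graph V) : nat :=
  \max_(S : {set V} | independent G S) #|S|.

Lemma complete_subproof (s : nat) :
  [forall e in [set e : {set 'I_s} | #|e| == 2]%SET, #|e| == 2].
Proof. by apply/forall_inP => e; rewrite inE. Qed.

Definition complete (s : nat) : graph 'I_s :=
  exist _ [set e : {set 'I_s} | #|e| == 2]%SET (complete_subproof s).

Lemma empty_subproof (V : finType) :
  [forall e in (finset.set0 : {set {set V}}), #|e| == 2].
Proof. by apply/forall_inP => e; rewrite inE. Qed.

Definition empty_graph (V : finType) : graph V :=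
  exist _ finset.set0 (empty_subproof V).

Lemma adjC (V : finType) (G : graph V) x y : adj G x y = adj G y x.
Proof. by rewrite /adj finset.setUC. Qed.

Lemma adjxx (V : finType) (G : graph V) x : adj G x x = false.
Proof.
apply/negP => h; have /forall_inP/(_ _ h) := valP G.
by rewrite finset.setUid cards1.
Qed.

Lemma adj_complete s (x y : 'I_s) : adj (complete s) x y = (x != y).
Proof. by rewrite /adj inE cards2; case: (x != y). Qed.

Lemma contains_completeP (V : finType) (G : graph V) (t : nat) :
  reflect (exists2 S : {set V}, #|S| = t &
             {in S &, forall x y, x != y -> adj G x y})
          (contains G (complete t)).
Proof.
apply: (iffP existsP) => [[h /andP[/injectiveP hinj /forallP hadj]]|[S St SG]].
  exists [set h i | i in 'I_t]%SET; first by rewrite card_imset ?card_ord.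
  move=> _ _ /imsetP[i _ ->] /imsetP[j _ ->] hij.
  move: (hadj i) => /forallP/(_ j)/implyP; apply; rewrite adj_complete.
  by apply: contraNneq hij => ->.
pose h := [ffun i : 'I_t => enum_val (cast_ord (esym St) i)].
have hinj : injective h.
  by move=> i j; rewrite !ffunE => /enum_val_inj /cast_ord_inj.
exists h; apply/andP; split; first exact/injectiveP.
apply/forallP => i; apply/forallP => j; apply/implyP; rewrite adj_complete.
move=> ij; apply: SG; rewrite ?(inj_eq hinj) // ffunE; exact: enum_valP.
Qed.

(* Every graph on [n] vertices contains a [K_t] or an independent set of size
   [m]. *)
Definition ramsey_prop (t m n : nat) : bool :=
  [forall G : graph 'I_n, contains G (complete t) ||
     [exists S : {set 'I_n}, (#|S| == m) && independent G S]].

Lemma ramsey_set (t m : nat) : exists n, forall (V : finType) (G : graph V)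
    (A : {set V}), n <= #|A| ->
  (exists S : {set V}, [/\ S \subset A, #|S| = t &
     {in S &, forall x y, x != y -> adj G x y}]) \/
  (exists S : {set V}, [/\ S \subset A, #|S| = m &
     {in S &, forall x y, ~~ adj G x y}]).
Proof.
elim: t m => [|t IHt] m.
  exists 0 => V G A _; left; exists finset.set0.
  by rewrite finset.sub0set cards0; split => // x y; rewrite inE.
elim: m => [|m [n2 IHm]].
  exists 0 => V G A _; right; exists finset.set0.
  by rewrite finset.sub0set cards0; split => // x y; rewrite inE.
have [n1 {}IHt] := IHt m.+1.
exists (n1 + n2).+1 => V G A nA.
have /card_gt0P[x xA] : 0 < #|A| by apply: leq_trans nA.
pose N := [set y in A | adj G x y]%SET.
pose M := [set y in A | (y != x) && ~~ adj G x y]%SET.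
have NM : (#|N| + #|M|).+1 = #|A|.
  rewrite (cardsD1 x A) xA add1n -cardsUI; congr S.
  have -> : (N :&: M)%SET = finset.set0.
    by apply/setP => y; rewrite !inE; case: (adj G x y); rewrite ?andbF.
  rewrite cards0 addn0; congr #|pred_of_set _|; apply/setP => y; rewrite !inE.
  case: eqVneq => [->|]; first by rewrite adjxx !andbF.
  by case: (adj G x y); case: (y \in A).
have [nN|nN] := leqP n1 #|N|.
  have [[S [SN St SG]]|[S [SN Sm SG]]] := IHt V G N nN; last first.
    right; exists S; split => //; apply: fintype.subset_trans SN _.
    by apply/fintype.subsetP => y; rewrite inE => /andP[].
  have Sx y : y \in S -> (y \in A) && adj G x y.
    by move=> /(fintype.subsetP SN); rewrite inE.
  have xS : x \notin S by apply/negP => /Sx; rewrite adjxx andbF.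
  left; exists (x |: S)%SET; split.
  - apply/fintype.subsetP => y; rewrite !inE => /orP[/eqP->//|/Sx/andP[]//].
  - by rewrite cardsU1 xS St.
  - move=> y z; rewrite !inE => /orP[/eqP->|yS] /orP[/eqP->|zS].
    + by rewrite eqxx.
    + by have /andP[] := Sx _ zS.
    + by rewrite adjC; have /andP[] := Sx _ yS.
    + exact: SG.
have nM : n2 <= #|M|.
  by rewrite -(leq_add2l #|N|) -ltnS NM; apply: leq_trans nA;
     rewrite ltnS leq_add2r ltnW.
have [[S [SM St SG]]|[S [SM Sm SG]]] := IHm V G M nM.
  left; exists S; split => //; apply: fintype.subset_trans SM _.
  by apply/fintype.subsetP => y; rewrite inE => /andP[].
have Sx y : y \in S -> [&& y \in A, y != x & ~~ adj G x y].
  by move=> /(fintype.subsetP SM); rewrite inE.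
have xS : x \notin S by apply/negP => /Sx; rewrite eqxx andbF.
right; exists (x |: S)%SET; split.
- apply/fintype.subsetP => y; rewrite !inE => /orP[/eqP->//|/Sx/andP[]//].
- by rewrite cardsU1 xS Sm.
- move=> y z; rewrite !inE => /orP[/eqP->|yS] /orP[/eqP->|zS].
  + by rewrite adjxx.
  + by have /and3P[] := Sx _ zS.
  + by rewrite adjC; have /and3P[] := Sx _ yS.
  + exact: SG.
Qed.

Lemma ramsey_exists (t m : nat) : exists n, ramsey_prop t m n.
Proof.
have [n h] := ramsey_set t m; exists n; apply/forallP => G.
have [|[S [_ St SG]]|[S [_ Sm SG]]] := h _ G [set: 'I_n]%SET.
- by rewrite cardsT card_ord.
- by apply/orP; left; apply/contains_completeP; exists S.
- apply/orP; right; apply/existsP; exists S; rewrite Sm eqxx /=.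
  by apply/forall_inP => x xS; apply/forall_inP => y yS; apply: SG.
Qed.

Definition ramsey (t m : nat) : nat := ex_minn (ramsey_exists t m).

(* The minimum of [indep_num G] over the [K_t]-free graphs [G] on [n]
   vertices: [indep_num G <= n] always holds, and the value [n] is taken at
   the empty graph, which is [K_t]-free as soon as [2 <= t]. *)
Definition Q (t n : nat) : nat :=
  \big[minn/n]_(G : graph 'I_n | ~~ contains G (complete t)) indep_num G.

Lemma Q_le (t n : nat) (G : graph 'I_n) :
  ~~ contains G (complete t) -> Q t n <= indep_num G.
Proof. by move=> Gt; rewrite /Q -leEnat -minEnat; apply: bigmin_le_cond. Qed.

Lemma Q_attained (t n : nat) : 2 <= t ->
  exists2 G : graph 'I_n, ~~ contains G (complete t) & Q t n = indep_num G.
Proof.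
move=> t2; rewrite /Q.
elim/big_ind: _ => [|_ _ [G Gt ->] [H Ht ->]|G Gt].
- have adj0 x y : adj (empty_graph 'I_n) x y = false by rewrite /adj inE.
  exists (empty_graph 'I_n).
    apply/negP => /contains_completeP[S St SG].
    have /card_gt1P[x [y [xS yS xy]]] : 1 < #|S| by rewrite St.
    by have := SG x y xS yS xy; rewrite adj0.
  apply/eqP; rewrite eqn_leq; apply/andP; split; last first.
    by apply/bigmax_leqP => S _; rewrite -[leqRHS]card_ord max_card.
  rewrite -[leqLHS]card_ord -cardsT; apply: (@leq_bigmax_cond _ _ (fun S : {set 'I_n} => #|S|)).
  by apply/forall_inP => x _; apply/forall_inP => y _; rewrite adj0.
- by case: (leqP (indep_num G) (indep_num H)) => _; [exists G|exists H].
- by exists G.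
Qed.

Lemma Q_succ_le (t n : nat) : 2 <= t -> Q t.+1 n <= Q t n.
Proof.
move=> t2; have [G Gt ->] := Q_attained n t2; apply: Q_le.
apply: contra Gt => /contains_completeP[S St SG]; apply/contains_completeP.
have /card_gt0P[x xS] : 0 < #|S| by rewrite St.
exists (S :\ x)%SET; first by move: St; rewrite (cardsD1 x) xS => -[].
by move=> y z; rewrite !inE => /andP[_ yS] /andP[_ zS]; apply: SG.
Qed.

End Graphs.

Section RamseyTuran.
Context {R : realType}.
Implicit Types (f g phi omega : nat -> R).

(* The empty [\max] is [0], as required when no such graph exists. *)
Definition RT (W : finType) (n : nat) (H : graph W) (x : R) : nat :=
  (\max_(G : graph 'I_n | ~~ contains G H && ((indep_num G)%:R < x)%R)
      #|edges G|)%N.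

Definition RT_density (W : finType) (H : graph W) f : nat -> \bar R :=
  fun n => ((RT n H (f n))%:R / n%:R ^+ 2)%:E.

Definition rho_tau_sup (W : finType) (H : graph W) f : \bar R :=
  limn_esup (RT_density H f).

Definition rho_tau_inf (W : finType) (H : graph W) f : \bar R :=
  limn_einf (RT_density H f).

(* This notion is meant for pairs with [g n <= f n] for all large [n].  That
   condition is not a conjunct, so that [~ phase_transition H f g] denies the
   inequality and cannot hold merely because [f] and [g] are in the wrong
   order.  See [Q_succ_le] and [vanishing_mul_le]. *)
Definition phase_transition (W : finType) (H : graph W) f g : Prop :=
  (rho_tau_sup H g < rho_tau_inf H f)%E.

Definition phi_phase_transition (W : finType) (H : graph W) phi f : Prop :=
  phi n @[n --> \oo] --> (0 : R) /\
  phase_transition H f (fun n => phi n * f n).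

Lemma vanishing_mul_le phi f : phi n @[n --> \oo] --> (0 : R) ->
  (forall n, 0 <= f n) -> \forall n \near \oo, phi n * f n <= f n.
Proof.
move=> phi0 f0; have /cvgr_lt/(_ 1 ltr01) := phi0.
by apply: filterS => n /ltW phi1; rewrite ler_piMl.
Qed.

Definition log2 (x : R) : R := ln x / ln 2.

Definition weak_phase_transition (W : finType) (H : graph W) f : Prop :=
  exists2 eps : R, 0 < eps &
    phi_phase_transition H (fun n => 2 `^ (- (log2 n%:R `^ (1 - eps)))) f.

Definition phi_eps (eps : R) omega : nat -> R :=
  fun n => 2 `^ (- (omega n * log2 n%:R `^ (1 - eps))).

Definition slowly_to_infinity omega : Prop :=
  omega n @[n --> \oo] --> +oo /\
  omega =o_\oo (fun n => log2 (log2 (log2 n%:R))).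

End RamseyTuran.

(* Main.v *)
(** Let k = (s - 1) / t, rounded down, and c = (1 - 1/k)/2.  Both parts follow from
    rho_tau_sup(K_s, phi Q(t,.)) <= c <= rho_tau_sup(K_s, Q(t+1,.)).

    The lower bound need only hold along the infinitely many n = R(t+1, m): take
    the join of k copies of (parts of) a K_{t+1}-free graph on n - 1 vertices
    with independence number less than m <= Q(t+1, n).

    For the upper bound, suppose G has independence number less than phi Q(t,n).
    A disjoint union of copies of a K_t-free induced subgraph of G would beat
    Q(t,n), so every set of at least 2 phi n vertices contains a K_t.  If G has
    more than (c + delta) n^2 edges, the Moon-Moser inequalities give a positive
    density of K_{k+1}'s.  Regarding these as a (k+1)-uniform hypergraph, k
    rounds of dependent random choice, each followed by picking a K_t in the
    selected vertex set, and a last choice of a K_t yield k + 1 copies of K_t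
    that are completely joined, i.e. a K_{(k+1)t}, which contains K_s. *)
Require Import Defs.
From mathcomp Require Import all_boot all_order all_algebra.
From mathcomp Require Import all_classical all_reals all_analysis.
From mathcomp Require Import zify ring lra.
Import Order.TTheory GRing.Theory Num.Theory.
Import numFieldNormedType.Exports.

Set Implicit Arguments.
Unset Strict Implicit.
Unset Printing Implicit Defensive.

(** * Cliques, independent sets, and graphs given by a relation *)

Section Graphs.
Import mathcomp.boot.fintype mathcomp.boot.finset.
Local Open Scope nat_scope.
Local Open Scope set_scope.

Implicit Types (V W : finType).

Definition clique V (G : graph V) (S : {set V}) : Prop :=
  {in S &, forall x y, x != y -> adj G x y}.

Lemma contains_complete_leq V (G : graph V) (s r : nat) :
  s <= r -> contains G (complete r) -> contains G (complete s).
Proof.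
move=> sr /contains_completeP[S Sr SG].
have [S' S'S S's] : exists2 S' : {set V}, S' \subset S & #|S'| = s.
  have := sr; rewrite -Sr => /card_geqP[l [ul ls lS]].
  exists [set x in l]; first by apply/subsetP => x; rewrite inE => /lS.
  by rewrite cardsE (card_uniqP ul).
apply/contains_completeP; exists S' => // x y xS yS.
by apply: SG; apply: (subsetP S'S).
Qed.

Lemma independent_leq V (G : graph V) (S : {set V}) :
  {in S &, forall x y, ~~ adj G x y} -> #|S| <= indep_num G.
Proof.
move=> SG; apply: (@leq_bigmax_cond _ _ (fun S : {set V} => #|S|)).
by apply/forall_inP => x xS; apply/forall_inP => y yS; apply: SG.
Qed.

Lemma indep_num_leq V (G : graph V) m :
  (forall S : {set V}, {in S &, forall x y, ~~ adj G x y} -> #|S| <= m) ->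
  indep_num G <= m.
Proof.
move=> h; apply/bigmax_leqP => S /forall_inP SG; apply: h => x y xS yS.
by have /forall_inP := SG _ xS; apply.
Qed.

Definition rel_edges V (e : rel V) : {set {set V}} :=
  [set S | [exists x, exists y, [&& S == [set x; y], x != y & e x y]]].

Lemma rel_graph_subproof V (e : rel V) : [forall S in rel_edges e, #|S| == 2].
Proof.
apply/forall_inP => S; rewrite inE => /existsP[x /existsP[y]].
by move=> /and3P[/eqP-> xy _]; rewrite cards2 xy.
Qed.

Definition rel_graph V (e : rel V) : graph V :=
  exist _ (rel_edges e) (rel_graph_subproof e).

Lemma set2_eq V (x y a b : V) : x != y -> [set x; y] = [set a; b] ->
  (a = x /\ b = y) \/ (a = y /\ b = x).
Proof.
move=> xy E.
have : x \in [set a; b] by rewrite -E set21.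
have : y \in [set a; b] by rewrite -E set22.
have : a \in [set x; y] by rewrite E set21.
have : b \in [set x; y] by rewrite E set22.
rewrite !inE.
by move=> /orP[]/eqP-> /orP[]/eqP->;
   rewrite ?eqxx ?(negbTE xy) ?(eq_sym y) ?(negbTE xy) //=; auto.
Qed.

Lemma adj_rel_graph V (e : rel V) : symmetric e -> irreflexive e ->
  adj (rel_graph e) =2 e.
Proof.
move=> es ei x y; apply/idP/idP.
  rewrite /adj inE => /existsP[a /existsP[b /and3P[/eqP E ab eab]]].
  by have [[-> ->]//|[-> ->]] := set2_eq ab (esym E); rewrite es.
move=> exy; rewrite /adj inE; apply/existsP; exists x; apply/existsP; exists y.
rewrite eqxx exy andbT /=; apply: contraTneq exy => ->; by rewrite ei.
Qed.

Lemma card_adj V (G : graph V) :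
  #|[set p : V * V | adj G p.1 p.2]| = (#|edges G|).*2.
Proof.
rewrite -sum1_card (partition_big (fun p : V * V => [set p.1; p.2])
  (mem (edges G))) /=; last by move=> p; rewrite inE.
rewrite -muln2 -sum_nat_const; apply: eq_bigr => e eG.
have /forall_inP/(_ _ eG)/cards2P[a [b [ab E]]] := valP G.
rewrite sum1dep_card -(_ : #|[set (a, b); (b, a)]| = 2); last first.
  by rewrite cards2 xpair_eqE (negbTE ab).
apply: eq_card => -[x y]; rewrite !inE /= !xpair_eqE; apply/andP/idP.
  case=> _ /eqP; rewrite E => /esym /(set2_eq ab)[[-> ->]|[-> ->]];
  by rewrite !eqxx ?orbT.
have Eba : [set b; a] = e by rewrite E setUC.
by move=> /orP[]/andP[/eqP-> /eqP->]; rewrite /adj -?E ?Eba.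
Qed.

(** * Disjoint unions and joins of copies of parts of a graph *)

Section Fibers.
Context {V W : finType} (b : nat) (c : V -> 'I_b) (h : V -> W)
  (hinj : forall x y, c x = c y -> h x = h y -> x = y).

Lemma exists_big_fiber (S : {set V}) m : b * m < #|S| ->
  exists i, m < #|[set x in S | c x == i]|.
Proof.
move=> bm; apply/existsP; apply: contraLR bm.
rewrite negb_exists => /forallP hm; rewrite -leqNgt.
rewrite -sum1_card (partition_big c predT) //=.
rewrite -[b in b * m]card_ord -sum_nat_const; apply: leq_sum => i _.
rewrite sum1dep_card; have := hm i; rewrite -leqNgt; apply: leq_trans.
by rewrite leq_eqVlt; apply/orP; left; apply/eqP; apply: eq_card => x; rewrite !inE.
Qed.

Lemma card_fiber_image (S : {set V}) i : {in S, forall x, c x = i} ->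
  #|[set h x | x in S]| = #|S|.
Proof.
move=> Si; apply: card_in_imset => x y xS yS; apply: hinj.
by rewrite (Si _ xS) (Si _ yS).
Qed.

(** [c x] is the index of the copy holding [x], and [h x] is the vertex of [G] that [x] copies; by
    [hinj] a copy may omit vertices of [G] but repeats none. *)
Definition copies (G : graph W) : graph V :=
  rel_graph (fun x y => (c x == c y) && adj G (h x) (h y)).

Definition join_copies (G : graph W) : graph V :=
  rel_graph (fun x y => (c x == c y) ==> adj G (h x) (h y)).

Lemma adj_copies G x y :
  adj (copies G) x y = (c x == c y) && adj G (h x) (h y).
Proof.
apply: adj_rel_graph => [u v|u]; first by rewrite eq_sym adjC.
by rewrite adjxx andbF.
Qed.

Lemma adj_join_copies G x y :
  adj (join_copies G) x y = ((c x == c y) ==> adj G (h x) (h y)).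
Proof.
apply: adj_rel_graph => [u v|u]; first by rewrite eq_sym adjC.
by rewrite eqxx adjxx.
Qed.

(** A clique lies in one fibre, where [h] is injective. The last conclusion locates the clique of
    [G] inside any set containing the range of [h]. *)
Lemma copies_clique G (S : {set V}) : clique (copies G) S ->
  exists T : {set W}, [/\ clique G T, #|T| = #|S| & T \subset [set h x | x : V]].
Proof.
move=> SG; exists [set h x | x in S]; split.
- move=> _ _ /imsetP[x xS ->] /imsetP[y yS ->] hxy.
  have : adj (copies G) x y by apply: SG => //; apply: contraNneq hxy => ->.
  by rewrite adj_copies => /andP[].
- apply: card_in_imset => x y xS yS hxy; apply/eqP/negPn/negP => xy.
  have := SG x y xS yS xy; rewrite adj_copies => /andP[/eqP cxy _].
  by move: xy; rewrite (hinj cxy hxy) eqxx.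
- by apply/subsetP => _ /imsetP[x _ ->]; apply: imset_f.
Qed.

Lemma copies_indep_num G : indep_num (copies G) <= b * indep_num G.
Proof.
apply: indep_num_leq => S SG; rewrite leqNgt; apply/negP.
move=> /exists_big_fiber[i]; apply/negP; rewrite -leqNgt.
rewrite -(@card_fiber_image _ i); last by move=> x; rewrite inE => /andP[_ /eqP].
apply: independent_leq => _ _ /imsetP[x + ->] /imsetP[y + ->].
rewrite !inE => /andP[xS /eqP cx] /andP[yS /eqP cy].
by have := SG x y xS yS; rewrite adj_copies cx cy eqxx.
Qed.

Lemma join_copies_clique G t s : contains (join_copies G) (complete s) ->
  b * t < s -> contains G (complete t.+1).
Proof.
move=> /contains_completeP[S <- SG] /exists_big_fiber[i].
rewrite -(@card_fiber_image _ i); last by move=> x; rewrite inE => /andP[_ /eqP].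
move=> tS; apply: (contains_complete_leq tS); apply/contains_completeP.
eexists; first reflexivity.
move=> _ _ /imsetP[x + ->] /imsetP[y + ->].
rewrite !inE => /andP[xS /eqP cx] /andP[yS /eqP cy] hxy.
have : adj (join_copies G) x y by apply: SG => //; apply: contraNneq hxy => ->.
by rewrite adj_join_copies cx cy eqxx.
Qed.

(** Vertices of different fibres are adjacent, so an independent set lies in a single fibre. *)
Lemma join_copies_indep_num G : indep_num (join_copies G) <= indep_num G.
Proof.
apply: indep_num_leq => S SG.
have [->|[x0 x0S]] := set_0Vmem S; first by rewrite cards0.
have Sc x : x \in S -> c x = c x0.
  move=> xS; have := SG x x0 xS x0S; rewrite adj_join_copies.
  by case: eqP.
rewrite -(card_fiber_image Sc); apply: independent_leq.
move=> _ _ /imsetP[x xS ->] /imsetP[y yS ->].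
by have := SG x y xS yS; rewrite adj_join_copies !Sc // eqxx.
Qed.

End Fibers.

(* If G[S] were K_t-free, a disjoint union of b <= M copies of it would be a
   K_t-free graph on at least n vertices with independence number at most
   b * indep_num G < Q t n. *)
Lemma clique_of_indep_num_lt_Q t n (G : graph 'I_n) (S : {set 'I_n}) M : 2 <= t ->
  indep_num G * M < Q t n -> 2 * n <= #|S| * M ->
  exists2 T : {set 'I_n}, T \subset S & #|T| = t /\ clique G T.
Proof.
move=> t2 GM nS.
have n0 : 0 < n.
  case: n G S GM nS => // G S; have [G' _ ->] := Q_attained 0 t2.
  move=> h _; suff : indep_num G' = 0 by move: h => /[swap] ->.
  apply/eqP; rewrite -leqn0; apply: indep_num_leq => S' _.
  by rewrite -[leqRHS]card_ord max_card.
set m := #|S| in nS.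
have m0 : 0 < m by move: nS; case: m => //; lia.
have mn : m <= n by rewrite -[leqRHS]card_ord max_card.
(* [b] is n/m rounded up: quotient and remainder by [m] give the copy and the vertex of [S], the
   last copy possibly being partial. *)
pose b := (n.-1 %/ m).+1.
have cb (x : 'I_n) : x %/ m < b by rewrite ltnS leq_div2r //; case: x => /=; lia.
pose c (x : 'I_n) := Ordinal (cb x).
pose h (x : 'I_n) : 'I_n := enum_val (Ordinal (ltn_pmod x m0)).
have hinj x y : c x = c y -> h x = h y -> x = y.
  move=> /(congr1 val) /= cxy /enum_val_inj /(congr1 val) /= hxy.
  by apply: val_inj => /=; rewrite (divn_eq x m) (divn_eq y m) cxy hxy.
(* Rounding up costs less than [m <= n], which accounts for the factor 2 in the hypothesis. *)
have bM : b <= M.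
  have : b * m <= 2 * n by rewrite /b mulSn; have := leq_divM n.-1 m; lia.
  by move=> bm; have := leq_trans bm nS; rewrite [m * M]mulnC leq_pmul2r.
have : contains (copies c h G) (complete t).
  apply: contraLR GM => /Q_le QG; rewrite -leqNgt; apply: leq_trans QG _.
  apply: leq_trans (copies_indep_num hinj _) _.
  by rewrite mulnC leq_mul2l bM orbT.
move=> /contains_completeP[T' T't /(copies_clique hinj)[T [TG TT' Th]]].
exists T; last by rewrite TT'.
apply: subset_trans Th _; apply/subsetP => _ /imsetP[x _ ->]; exact: enum_valP.
Qed.

End Graphs.

(** * Moon-Moser inequalities and the power mean inequality *)

Section CliqueCounts.
Import mathcomp.boot.fintype mathcomp.boot.finset.
Local Open Scope nat_scope.
Local Open Scope set_scope.

Section Insertion.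
Context {V : finType} {r : nat}.
Implicit Types (v : V) (x : {ffun 'I_r -> V}) (i : 'I_r.+1).

Definition insert i v x : {ffun 'I_r.+1 -> V} :=
  [ffun j => oapp x v (unlift i j)].

Lemma insert_id i v x : insert i v x i = v.
Proof. by rewrite ffunE unlift_none. Qed.

Lemma insert_lift i v x j : insert i v x (lift i j) = x j.
Proof. by rewrite ffunE liftK. Qed.

Lemma sum_insert i (P : pred {ffun 'I_r.+1 -> V}) F :
  \sum_(x | P x) F x =
  \sum_x \sum_(v | P (insert i v x)) F (insert i v x).
Proof.
rewrite pair_big_dep /=.
rewrite (reindex (fun p : {ffun 'I_r -> V} * V => insert i p.2 p.1)) //=.
exists (fun x : {ffun 'I_r.+1 -> V} => ([ffun j => x (lift i j)], x i)) => [[x v] _|x _] /=.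
  congr pair; last by rewrite insert_id.
  by apply/ffunP => j; rewrite ffunE insert_lift.
apply/ffunP => j; rewrite ffunE; case: unliftP => [k ->|->] //=.
by rewrite ffunE.
Qed.

End Insertion.

Section MoonMoser.
Context {V : finType} (G : graph V).

(** Cliques are ordered: irreflexivity of [adj] makes the entries distinct, so each r-clique is
    counted r! times. *)
Definition clique_tuple r (x : {ffun 'I_r -> V}) :=
  [forall i, forall j, (i != j) ==> adj G (x i) (x j)].

Definition clique_count r := #|[set x : {ffun 'I_r -> V} | clique_tuple x]|.

Definition common_nbhd r (x : {ffun 'I_r -> V}) :=
  [set v | [forall j, adj G v (x j)]].

Lemma clique_tuple_insert r i v (x : {ffun 'I_r -> V}) :
  clique_tuple (insert i v x) = clique_tuple x && (v \in common_nbhd x).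
Proof.
rewrite inE; apply/idP/andP => [/forallP vx|[/forallP hx /forallP hv]].
  split; last first.
    apply/forallP => j; have /forallP/(_ (lift i j)) := vx i.
    by rewrite neq_lift insert_id insert_lift.
  apply/forallP => j; apply/forallP => k; apply/implyP => jk.
  have /forallP/(_ (lift i k)) := vx (lift i j).
  by rewrite (inj_eq lift_inj) jk !insert_lift.
apply/forallP => j; apply/forallP => k.
have [j' ->|->] := unliftP i j; have [k' ->|->] := unliftP i k.
- by rewrite (inj_eq lift_inj) !insert_lift; have /forallP := hx j'; apply.
- by rewrite insert_id insert_lift adjC hv implybT.
- by rewrite insert_id insert_lift hv implybT.
- by rewrite eqxx.
Qed.

Lemma clique_countS r : clique_count r.+1 =
  \sum_(x : {ffun 'I_r -> V} | clique_tuple x) #|common_nbhd x|.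
Proof.
rewrite /clique_count -sum1dep_card (sum_insert ord0) [RHS]big_mkcond.
apply: eq_bigr => x _; under eq_bigl => v do rewrite clique_tuple_insert.
case: (clique_tuple x); first by rewrite sum1dep_card cardsE.
by rewrite big_pred0.
Qed.

Lemma clique_count1 : clique_count 1 = #|V|.
Proof.
rewrite /clique_count (_ : [set x | _] = setT).
  by rewrite cardsT card_ffun card_ord expn1.
apply/setP => x; rewrite !inE; apply/forallP => i; apply/forallP => j.
by rewrite !ord1.
Qed.

Lemma clique_count2 : clique_count 2 = (#|edges G|).*2.
Proof.
rewrite clique_countS -card_adj -sum1dep_card.
rewrite (_ : \sum_(p | adj G p.1 p.2) 1 = \sum_v \sum_(w | adj G v w) 1).
  2: by rewrite pair_big_dep.
rewrite (reindex (fun v => [ffun _ : 'I_1 => v])) /=; last first.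
  exists (fun x => x ord0) => [v _|x _]; first by rewrite ffunE.
  by apply/ffunP => i; rewrite ffunE ord1.
apply: eq_big => [v|v _].
  by apply/forallP => i; apply/forallP => j; rewrite !ord1.
rewrite sum1dep_card; apply: eq_card => w; rewrite !inE.
by apply/forallP/idP => [/(_ ord0)|vw i]; rewrite ffunE adjC.
Qed.

(** Cauchy-Schwarz: once doubled, both sides are double sums that compare termwise by 2ab <= a^2 +
    b^2. *)
Lemma sqr_sum_leq (I : finType) (P : pred I) (F : I -> nat) :
  (\sum_(i | P i) F i) ^ 2 <= #|P| * \sum_(i | P i) F i ^ 2.
Proof.
rewrite -(@leq_pmul2l 2) //.
have -> : 2 * (\sum_(i | P i) F i) ^ 2 =
    \sum_(i | P i) \sum_(j | P j) 2 * (F i * F j).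
  rewrite -mulnn big_distrl big_distrr; apply: eq_bigr => i _ /=.
  by rewrite big_distrr big_distrr; apply: eq_bigr => j _ /=; rewrite mulnA.
have -> : 2 * (#|P| * \sum_(i | P i) F i ^ 2) =
    \sum_(i | P i) \sum_(j | P j) (F i ^ 2 + F j ^ 2).
  under [RHS]eq_bigr => i _ do rewrite big_split sum_nat_const.
  by rewrite big_split -big_distrr sum_nat_const /=; lia.
by apply: leq_sum => i _; apply: leq_sum => j _; apply: nat_Cauchy.
Qed.

(* Double counting of pairs (x, w) of an ordered (r+1)-clique x and a vertex w,
   weighted by the number of i such that w is joined to all x j with j != i.
   This weight is r + 1 if w is joined to all of x, and at most 1 otherwise. *)
Lemma sum_sqr_common_nbhd r :
  r.+1 * \sum_(x : {ffun 'I_r -> V} | clique_tuple x) #|common_nbhd x| ^ 2 <=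
  #|V| * clique_count r.+1 + r * clique_count r.+2.
Proof.
pose almost i (x : {ffun 'I_r.+1 -> V}) w :=
  [forall j, (j != i) ==> adj G w (x j)].
have -> : r.+1 * \sum_(x : {ffun 'I_r -> V} | clique_tuple x)
    #|common_nbhd x| ^ 2 = \sum_(i < r.+1) \sum_(x | clique_tuple x)
    #|[set w | almost i x w]|.
  rewrite -[r.+1 in LHS]card_ord -sum_nat_const; apply: eq_bigr => i _.
  rewrite (sum_insert i) big_mkcond; apply: eq_bigr => x _.
  under [RHS]eq_bigl => v do rewrite clique_tuple_insert.
  case: (clique_tuple x); last by rewrite big_pred0.
  rewrite -mulnn -sum_nat_const; apply: eq_big => [v|v _].
    by rewrite inE.
  apply: eq_card => w; rewrite !inE; apply/forallP/forallP => h j.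
    apply/implyP; have [k ->|->] := unliftP i j; last by rewrite eqxx.
    by rewrite insert_lift h.
  by have := h (lift i j); rewrite eq_sym neq_lift insert_lift.
rewrite exchange_big /= (clique_countS r.+1).
have -> : clique_count r.+1 = \sum_(x : {ffun 'I_r.+1 -> V} | clique_tuple x) 1.
  by rewrite sum1dep_card.
rewrite !big_distrr -big_split /=; apply: leq_sum => x _.
have -> : \sum_(i < r.+1) #|[set w | almost i x w]| =
    \sum_w \sum_(i < r.+1) almost i x w.
  rewrite exchange_big; apply: eq_bigr => i _.
  by rewrite -sum1dep_card big_mkcond.
rewrite muln1 -sum1dep_card big_distrr /= -[#|V|]sum1_card.
rewrite [X in _ + X]big_mkcond -big_split /=; apply: leq_sum => w _.
rewrite muln1.
have [/forallP hw|] := boolP [forall j, adj G w (x j)].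
  apply: (@leq_trans (\sum_(i < r.+1) 1)); first by apply: leq_sum => i _; case: almost.
  by rewrite sum1_card card_ord.
rewrite negb_forall addn0 => /existsP[j wj]; rewrite (bigD1 j) //=.
rewrite big1 ?addn0; first by case: almost.
move=> i ij; apply/eqP; rewrite eqb0 negb_forall; apply/existsP; exists j.
by rewrite negb_imply eq_sym ij.
Qed.

(** Cauchy-Schwarz for the sizes of the common neighbourhoods of the r-cliques, which sum to
    [clique_count r.+1] and whose squares are controlled by [sum_sqr_common_nbhd]. *)
Lemma moon_moser r : r.+1 * clique_count r.+1 ^ 2 <=
  clique_count r * (#|V| * clique_count r.+1 + r * clique_count r.+2).
Proof.
apply: leq_trans (leq_mul (leqnn _) (sum_sqr_common_nbhd r)).
rewrite [leqRHS]mulnCA leq_pmul2l // clique_countS.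
have -> : clique_count r = #|@clique_tuple r| by rewrite /clique_count cardsE.
exact: sqr_sum_leq.
Qed.

End MoonMoser.

(** The inductive step adds the case q, multiplied by y, to 2xy <= x^2 + y^2, multiplied by (q+1)
    x^q. *)
Lemma weighted_am_gm (x y q : nat) :
  q.+1 * (x ^ q * y) <= y ^ q.+1 + q * x ^ q.+1.
Proof.
elim: q => [|q IH]; first by rewrite expn0 mul0n addn0 !mul1n expn1.
have := leq_mul IH (leqnn y).
have := leq_mul (leqnn (q.+1 * x ^ q)) (nat_Cauchy x y).
rewrite !expnS.
set a := x ^ q; set b := y ^ q.
nia.
Qed.

(** N/D bounds the mean of [F] from below. Summing the weighted AM-GM inequality at N and [D * F i]
    is the tangent-line proof of Jensen's inequality, free of division. *)
Lemma power_mean (I : finType) (F : I -> nat) (N D q : nat) :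
  #|I| * N <= D * \sum_i F i -> #|I| * N ^ q <= D ^ q * \sum_i F i ^ q.
Proof.
case: q => [|q] h; first by rewrite !mul1n muln1 sum1_card.
have : \sum_(i : I) q.+1 * (N ^ q * (D * F i)) <=
       \sum_i ((D * F i) ^ q.+1 + q * N ^ q.+1) by apply: leq_sum => i _; exact: weighted_am_gm.
have -> : \sum_(i : I) ((D * F i) ^ q.+1 + q * N ^ q.+1) =
    \sum_(i : I) (D * F i) ^ q.+1 + #|I| * (q * N ^ q.+1).
  by rewrite big_split -sum_nat_const.
rewrite -!big_distrr /=.
have -> : \sum_i (D * F i) ^ q.+1 = D ^ q.+1 * \sum_i F i ^ q.+1.
  by rewrite big_distrr; apply: eq_bigr => i _; rewrite expnMn.
have := leq_mul (leqnn (q.+1 * N ^ q)) h.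
rewrite !expnS; set a := N ^ q; set n := #|I|.
have -> : q.+1 * a * (n * N) = n * (q * (N * a)) + n * (N * a) by ring.
rewrite [q.+1 * (a * _)]mulnA; lia.
Qed.

End CliqueCounts.

(** * Dependent random choice and its iteration *)

Section DRC.
Import mathcomp.boot.fintype mathcomp.boot.finset.
Local Open Scope nat_scope.
Local Open Scope set_scope.

Lemma leq_expW (e m n : nat) : m <= n -> m ^ e <= n ^ e.
Proof. by case: e => // e; rewrite leq_exp2r. Qed.

Lemma card_subsets_leq (V : finType) t :
  #|[set T : {set V} | #|T| == t]| <= #|V| ^ t.
Proof.
rewrite card_draws; apply: leq_trans (_ : #|V| ^_ t <= _).
  by rewrite bin_ffactd leq_div.
rewrite ffact_prod -[t in leqRHS]card_ord -prod_nat_const.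
by apply: leq_prod => i _; apply: leq_subr.
Qed.

(* For y uniform in A^q, the set U y of the v related to all y i has mean size at
   least |V| 2^(-qa), by the power mean inequality, whereas the mean number of
   bad sets T in U y is at most |V|^t 2^(-gq); so some U y is large and free of
   bad sets. *)
Lemma dependent_random_choice (V A : finType) (H : V -> pred A)
    (t a g q M : nat) :
  0 < #|V| -> 0 < #|A| ->
  #|V| * #|A| <= 2 ^ a * \sum_v #|[set x | H v x]| ->
  q * a + 2 <= M -> #|V| ^ t * 2 ^ M <= 2 ^ (g * q) ->
  exists U : {set V}, 2 * #|V| <= #|U| * 2 ^ M /\
    forall T : {set V}, T \subset U -> #|T| = t ->
      #|A| <= 2 ^ g * #|[set x | [forall v in T, H v x]]|.
Proof.
move=> V0 A0 /(power_mean q) hH qaM gM.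
set n := #|V| in V0 hH gM *; set N := #|A| in A0 hH *.
pose nb (T : {set V}) := [set x | [forall v in T, H v x]].
pose U (y : {ffun 'I_q -> A}) := [set v | [forall i, H v (y i)]].
pose bad (T : {set V}) := (#|T| == t) && (2 ^ g * #|nb T| < N).
have [/existsP[y /andP[yU /forallP ybad]]|] := boolP
  [exists y, (2 * n <= #|U y| * 2 ^ M) &&
    [forall T : {set V}, (T \subset U y) ==> ~~ bad T]].
  exists (U y); split=> // T TU Tt; have /implyP/(_ TU) := ybad T.
  by rewrite /bad Tt eqxx -leqNgt.
rewrite negb_exists => /forallP noy; exfalso.
(* Each [U y] is small or contains a bad set; in the second case the trivial bound [n] on its size
   is charged to that set. *)
have Uy y : #|U y| * 2 ^ M <=
    2 * n + n * 2 ^ M * \sum_(T | bad T) (T \subset U y).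
  have := noy y; rewrite negb_and => /orP[|].
    by rewrite -ltnNge => /ltnW h; apply: leq_trans h _; apply: leq_addr.
  rewrite negb_forall => /existsP[T]; rewrite negb_imply negbK => /andP[TU Tbad].
  have s1 : 0 < \sum_(T | bad T) (T \subset U y) by rewrite (bigD1 T) //= TU.
  apply: leq_trans (leq_addl _ _); apply: leq_trans (leq_pmulr _ s1).
  by rewrite leq_mul2r max_card orbT.
have card_pow (P : pred A) :
    #|[set y : {ffun 'I_q -> A} | [forall i, P (y i)]]| = #|P| ^ q.
  rewrite -[q in RHS]card_ord -card_ffun_on cardsE; apply: eq_card => y.
  by apply/forallP/ffun_onP.
have sumU : \sum_y #|U y| = \sum_v #|[set x | H v x]| ^ q.
  under [RHS]eq_bigr => v _ do rewrite cardsE -card_pow -sum1dep_card big_mkcond.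
  rewrite exchange_big; apply: eq_bigr => y _.
  by rewrite -sum1dep_card big_mkcond.
have sumbad (T : {set V}) : \sum_y (T \subset U y) = #|nb T| ^ q.
  rewrite /nb cardsE -card_pow -sum1dep_card [RHS]big_mkcond.
  apply: eq_bigr => y _.
  rewrite (_ : (T \subset U y) = [forall i, [forall v in T, H v (y i)]]); first by case: forallP.
  apply/subsetP/forallP => [h i|h v vT].
    by apply/forall_inP => v /h; rewrite inE => /forallP.
  by rewrite inE; apply/forallP => i; have /forall_inP := h i; apply.
have sum_bad : (\sum_(T | bad T) #|nb T| ^ q) * 2 ^ (g * q) <= n ^ t * N ^ q.
  rewrite big_distrl /=.
  apply: (@leq_trans (\sum_(T | bad T) N ^ q)).
    apply: leq_sum => T /andP[_ /ltnW h].
    by rewrite mulnC expnM -expnMn; apply: leq_expW.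
  rewrite sum_nat_const leq_mul2r; apply/orP; right.
  apply: leq_trans _ (card_subsets_leq V t); rewrite cardsE.
  by apply: subset_leq_card; apply/subsetP => T /andP[].
have : (\sum_y #|U y|) * 2 ^ M <= \sum_(y : {ffun 'I_q -> A})
   (2 * n + n * 2 ^ M * \sum_(T | bad T) (T \subset U y)).
  by rewrite big_distrl; apply: leq_sum => y _.
have -> : \sum_(y : {ffun 'I_q -> A})
   (2 * n + n * 2 ^ M * \sum_(T | bad T) (T \subset U y)) =
   N ^ q * (2 * n) + n * 2 ^ M * \sum_(T | bad T) #|nb T| ^ q.
  rewrite big_split sum_nat_const card_ffun card_ord; congr (_ + _).
  rewrite -big_distrr exchange_big; congr (_ * _).
  by apply: eq_bigr => T _.
rewrite sumU.
set S := \sum_v _ in hH *; set W := \sum_(T | _) _ in sum_bad *.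
have W_leq : W * 2 ^ M <= N ^ q.
  rewrite -(@leq_pmul2r (2 ^ (g * q))) ?expn_gt0 // mulnAC.
  apply: leq_trans (leq_mul sum_bad (leqnn _)) _.
  by rewrite mulnAC mulnC leq_mul2l gM orbT.
(* In units of n N^q, small [U y] contribute 2 and bad sets 1, while [q * a + 2 <= M] makes 2^M at
   least 4 * 2^(qa). *)
move=> SW; suff : 2 ^ M * (n * N ^ q) <= 2 ^ (q * a) * 3 * (n * N ^ q).
  rewrite leq_pmul2r; last by rewrite muln_gt0 V0 expn_gt0 A0.
  have : 2 ^ (q * a) * 4 <= 2 ^ M by rewrite -(expnD 2 _ 2) leq_exp2l.
  have : 0 < 2 ^ (q * a) by rewrite expn_gt0.
  lia.
have SM : S * 2 ^ M <= 3 * (n * N ^ q).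
  by have := leq_mul (leqnn n) W_leq; move: SW; lia.
have := leq_mul hH (leqnn (2 ^ M)); have := leq_mul (leqnn (2 ^ (q * a))) SM.
rewrite -expnM [a * q]mulnC.
lia.
Qed.

(** [a i] is the density exponent while i + 1 coordinates remain. Dependent random choice in
    coordinate 0, against tuples of the others, gives a large set; [hC] finds [T] in it, and
    induction applies to the common link of [T]. The base case applies [hC] to [H] itself, hence
    [(a 0).+1 <= M]. *)
Lemma iterated_drc (V : finType) (C : {set V} -> Prop) (t M r : nat)
    (a : nat -> nat) :
  0 < #|V| ->
  (forall S : {set V}, 2 * #|V| <= #|S| * 2 ^ M ->
     exists2 T : {set V}, T \subset S & #|T| = t /\ C T) ->
  (a 0).+1 <= M ->
  (forall i, i < r -> exists2 q, q * a i.+1 + 2 <= M &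
     #|V| ^ t * 2 ^ M <= 2 ^ (a i * q)) ->
  forall H : pred {ffun 'I_r.+1 -> V},
    #|V| ^ r.+1 <= 2 ^ a r * #|[set x | H x]| ->
  exists T : 'I_r.+1 -> {set V}, (forall i, #|T i| = t /\ C (T i)) /\
    forall x : {ffun 'I_r.+1 -> V}, (forall i, x i \in T i) -> H x.
Proof.
move=> V0 hC a0 + H; elim: r H => [|r IH] H haq hH.
  have [|T TS Tt] := hC [set v | H [ffun=> v]].
    have -> : #|[set v | H [ffun=> v]]| = #|[set x | H x]|.
      have inj : injective (fun v : V => [ffun _ : 'I_1 => v]).
        by move=> v w /ffunP/(_ ord0); rewrite !ffunE.
      rewrite -(card_imset _ inj); apply: eq_card => x.
      rewrite inE; apply/imsetP/idP => [[v + ->]|Hx]; first by rewrite inE.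
      have xE : x = [ffun=> x ord0].
        by apply/ffunP => i; rewrite ffunE ord1.
      by exists (x ord0); rewrite // inE -xE.
    rewrite expn1 in hH.
    have := leq_mul (leqnn 2) hH; have : 2 ^ (a 0).+1 <= 2 ^ M by rewrite leq_exp2l.
    rewrite expnS => h h2; apply: leq_trans h2 _.
    by rewrite mulnA mulnC leq_mul2l h orbT.
  exists (fun=> T); split=> // x xT; have /(subsetP TS) := xT ord0.
  rewrite inE; congr (H _); apply/ffunP => i; by rewrite ffunE ord1.
have [//|q qM gM] := haq r.
have [||U [UV HU]] := @dependent_random_choice _ _
  (fun v x => H (insert ord0 v x)) t (a r.+1) (a r) q M V0 _ _ qM gM.
- by rewrite card_ffun card_ord expn_gt0 V0.
- rewrite card_ffun card_ord -expnS; apply: leq_trans hH _.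
  rewrite leq_mul2l; apply/orP; right.
  rewrite -sum1dep_card (sum_insert ord0).
  rewrite (eq_bigr (fun v => \sum_(x | H (insert ord0 v x)) 1)); last first.
    by move=> v _; rewrite sum1dep_card.
  by rewrite (exchange_big_dep predT).
have [T TU [Tt TC]] := hC U UV.
have := HU T TU Tt; rewrite card_ffun card_ord.
case/IH => [i ir|T' [T'C T'H]]; first by apply: haq; apply: leqW.
exists (fun i => oapp T' T (unlift ord0 i)); split=> [i|x xT].
  by case: unliftP => [j _|_] /=; [exact: T'C|].
have -> : x = insert ord0 (x ord0) [ffun i => x (lift ord0 i)].
  apply/ffunP => i; rewrite ffunE; case: unliftP => [k ->|->] //=.
  by rewrite ffunE.
have /forall_inP : [forall v in T, H (insert ord0 v [ffun i => x (lift ord0 i)])].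
  by apply: T'H => i; rewrite ffunE; have := xT (lift ord0 i); rewrite liftK.
by apply; have := xT ord0; rewrite unlift_none.
Qed.

(** Any two vertices from different [T i] extend to a transversal, so they are adjacent.
    Irreflexivity then makes the [T i] disjoint, and their union has [r * t] vertices. *)
Lemma clique_tuple_blowup (V : finType) (G : graph V) (t r : nat)
    (T : 'I_r -> {set V}) :
  (forall i, #|T i| = t /\ clique G (T i)) ->
  (forall x : {ffun 'I_r -> V}, (forall i, x i \in T i) -> clique_tuple G x) ->
  contains G (complete (r * t)).
Proof.
move=> TG xG.
(* Extending to a transversal needs every [T i] to be nonempty. *)
have [->|t0] := posnP t.
  rewrite muln0; apply/contains_completeP.
  by exists set0; rewrite ?cards0 // => x y; rewrite inE.
have /fin_all_exists[x0 x0T] i : exists v, v \in T i.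
  by apply/card_gt0P; have [->] := TG i.
have cross i j v w : i != j -> v \in T i -> w \in T j -> adj G v w.
  move=> ij vi wj.
  pose x := [ffun k => if k == i then v else if k == j then w else x0 k].
  have /forallP/(_ i)/forallP/(_ j) : clique_tuple G x.
    by apply: xG => k; rewrite ffunE; case: eqP => [->//|_]; case: eqP => [->//|_].
  by rewrite ij !ffunE eqxx eq_sym (negbTE ij) eqxx.
apply/contains_completeP; exists (\bigcup_i T i).
  rewrite -sum1_card partition_disjoint_bigcup /=; last first.
    move=> i j ij; rewrite -setI_eq0; apply/eqP/setP => v; rewrite !inE.
    apply/negP => /andP[vi vj]; by have := cross i j v v ij vi vj; rewrite adjxx.
  rewrite -[r in RHS]card_ord -sum_nat_const; apply: eq_bigr => i _.
  by rewrite sum1_card; have [] := TG i.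
move=> v w /bigcupP[i _ vi] /bigcupP[j _ wj] vw.
have [ij|ij] := eqVneq i j; last exact: cross ij vi wj.
by have [_] := TG i; apply; rewrite // ij.
Qed.

(* With X about (log n)^(1/(3r)), the set of cliques has density 2^(-X), and the
   densities of the successive links are 2^(-X^4), 2^(-X^7), ..., 2^(-X^(3r-2)),
   the last one still larger than the threshold 2 * 2^(-X^(3r-1)). *)
Lemma many_cliques_contains (V : finType) (G : graph V) (t r B X : nat) :
  0 < #|V| -> 0 < r ->
  (forall S : {set V}, 2 * #|V| <= #|S| * 2 ^ (X ^ (3 * r).-1) ->
     exists2 T : {set V}, T \subset S & #|T| = t /\ clique G T) ->
  #|V| <= 2 ^ (B * X ^ (3 * r)) -> B * t + 3 <= X ->
  #|V| ^ r <= 2 ^ X * clique_count G r ->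
  contains G (complete (r * t)).
Proof.
move=> V0; case: r => // r _ hG hB hX hK.
pose a i := X ^ (3 * (r - i)).+1.
have X0 : 0 < X by lia.
have [|||T [TG TH]] := @iterated_drc V (clique G) t _ r a V0 hG _ _ (@clique_tuple V G r.+1).
- rewrite /a subn0 (_ : (3 * r.+1).-1 = (3 * r).+2); last by lia.
  by rewrite (expnS _ (3 * r).+1); have := expn_gt0 X (3 * r).+1; rewrite X0; nia.
(* For this q, q a_(i+1) = X^(3r+1) is one power of X below the exponent M = X^(3r+2), and q a_i =
   X^(3r+4) is one above the bound [B * X ^ (3 * r.+1)] on log n; [B * t + 3 <= X] absorbs the
   constants. *)
- move=> i ir; exists (X ^ (3 * i).+3).
    rewrite /a -expnD.
    rewrite (_ : (3 * r.+1).-1 = ((3 * i).+3 + (3 * (r - i.+1)).+1).+1); last by lia.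
    set e := (3 * i).+3 + _; rewrite expnS.
    have y0 : 0 < X ^ e by rewrite expn_gt0 X0.
    have X3 : 3 <= X by lia.
    by have := leq_mul X3 (leqnn (X ^ e)); lia.
  rewrite /a -expnD.
  have [e eE] : exists e, 3 * r.+1 = e.+1 by exists (3 * r).+2; lia.
  rewrite (_ : (3 * (r - i)).+1 + _ = e.+2); last by lia.
  rewrite eE /= in hB *.
  apply: leq_trans (leq_mul (leq_expW t hB) (leqnn _)) _.
  rewrite -expnM -expnD leq_exp2l // !expnS.
  have : X ^ e * (B * t + 3) <= X ^ e * X by rewrite leq_mul2l hX orbT.
  move=> /(leq_mul (leqnn X)).
  have : X ^ e <= X * X ^ e by rewrite leq_pmull.
  set y := X ^ e; lia.
- by rewrite /a subnn muln0 expn1.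
- exact: clique_tuple_blowup TG TH.
Qed.


End DRC.

(** * The lower bound construction from Ramsey graphs *)

Section Turan.
Import mathcomp.boot.fintype mathcomp.boot.finset.
Local Open Scope nat_scope.
Local Open Scope set_scope.

Lemma independent_sub (V : finType) (G : graph V) m : m <= indep_num G ->
  exists2 S : {set V}, #|S| = m & independent G S.
Proof.
have [|S SG E] := @eq_bigmax_cond _ (independent G) (fun S : {set V} => #|S|).
  apply/card_gt0P; exists set0; rewrite unfold_in.
  by apply/forall_inP => x; rewrite inE.
rewrite (E : indep_num G = #|S|) => {E}.
move=> /card_geqP[l [ul lm lS]]; exists [set x in l].
  by rewrite cardsE (card_uniqP ul).
apply/forall_inP => x; rewrite inE => /lS xS.
apply/forall_inP => y; rewrite inE => /lS yS.
by have /forall_inP/(_ _ xS)/forall_inP := SG; apply.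
Qed.

Lemma indep_num_le_card (V : finType) (G : graph V) : indep_num G <= #|V|.
Proof. by apply: indep_num_leq => S _; apply: max_card. Qed.

Lemma Q_ramsey t m : 2 <= t -> m <= Q t (ramsey t m).
Proof.
move=> t2; have [G Gt ->] := Q_attained (ramsey t m) t2.
rewrite /ramsey in G Gt *; case: ex_minnP G Gt => n /forallP nP _ G Gt.
have := nP G; rewrite (negbTE Gt) => /existsP[S /andP[/eqP <- SG]].
by apply: independent_leq => x y xS yS; have /forall_inP/(_ _ xS)/forall_inP := SG; apply.
Qed.

Lemma ramsey_ge t m : 2 <= t -> m <= ramsey t m.
Proof.
move=> t2; apply: leq_trans (Q_ramsey m t2) _.
have [G _ ->] := Q_attained (ramsey t m) t2.
by rewrite -[leqRHS]card_ord indep_num_le_card.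
Qed.

Lemma ramsey_pred_graph t m n : n < ramsey t m ->
  exists2 G : graph 'I_n, ~~ contains G (complete t) & indep_num G < m.
Proof.
rewrite /ramsey; case: ex_minnP => r _ /(_ n) rmin nr.
have : ~~ ramsey_prop t m n by apply/negP => /rmin; rewrite leqNgt nr.
rewrite negb_forall => /existsP[G]; rewrite negb_or => /andP[Gt Gm].
exists G => //; rewrite ltnNge; apply: contra Gm => /independent_sub[S Sm SG].
by apply/existsP; exists S; rewrite Sm eqxx.
Qed.

(** The copies sit on the residue classes modulo [k]. Non-adjacent ordered pairs, loops included,
    stay within a class, and a class has at most (n-1)/k + 1 vertices; this gives the term
    [n * (n + k)]. *)
Lemma turan_ramsey_graph t k s m : 2 <= t -> 2 <= k -> k * t < s -> 2 <= m ->
  let n := ramsey t.+1 m in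
  exists2 G : graph 'I_n,
    ~~ contains G (complete s) && (indep_num G < Q t.+1 n) &
    k * n ^ 2 <= k * (#|edges G|).*2 + n * (n + k).
Proof.
move=> t2 k2 kts m2; set n := ramsey t.+1 m.
have tS2 : 2 <= t.+1 by apply: leqW.
have mn : m <= n by apply: ramsey_ge.
have [|G0 G0t G0m] := @ramsey_pred_graph t.+1 m n.-1; first by rewrite -/n; lia.
have k0 : 0 < k by lia.
pose c (x : 'I_n) := Ordinal (ltn_pmod x k0).
(* With [2 <= k], each class fits into the n - 1 vertices of [G0]. *)
have hlt (x : 'I_n) : x %/ k < n.-1.
  rewrite ltn_divLR //; have := ltn_ord x; nia.
pose h (x : 'I_n) := Ordinal (hlt x).
have hinj x y : c x = c y -> h x = h y -> x = y.
  move=> /(congr1 val) /= cxy /(congr1 val) /= hxy.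
  by apply: val_inj => /=; rewrite (divn_eq x k) (divn_eq y k) cxy hxy.
exists (join_copies c h G0).
  apply/andP; split.
    by apply: contra G0t => /(join_copies_clique hinj); apply.
  apply: leq_ltn_trans (join_copies_indep_num hinj _) _.
  exact: leq_trans G0m (Q_ramsey m tS2).
rewrite -card_adj.
have cC := cardsC [set p : 'I_n * 'I_n | adj (join_copies c h G0) p.1 p.2].
rewrite card_prod card_ord mulnn in cC.
rewrite -cC mulnDr leq_add2l.
have : #|~: [set p : 'I_n * 'I_n | adj (join_copies c h G0) p.1 p.2]| <=
    \sum_(x < n) \sum_(y < n | c y == c x) 1.
  rewrite pair_big_dep sum1_card; apply: subset_leq_card.
  apply/subsetP => -[x y]; rewrite !inE adj_join_copies /= negb_imply.
  by rewrite eq_sym => /andP[].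
move/(leq_mul (leqnn k))/leq_trans; apply.
rewrite big_distrr -[n in leqRHS]card_ord -sum_nat_const; apply: leq_sum => x _.
rewrite /= sum1dep_card.
have : #|[set y | c y == c x]| <= n.-1 %/ k + 1.
  have hlt' (y : 'I_n) : y %/ k < n.-1 %/ k + 1.
    rewrite addn1 ltnS leq_div2r //; have := ltn_ord y; lia.
  rewrite -[leqRHS]card_ord.
  rewrite -(@card_in_imset _ _ (fun y => Ordinal (hlt' y))) ?max_card // => y z.
  rewrite !inE => /eqP cy /eqP cz /(congr1 val) /= hyz.
  by apply: hinj; [rewrite cy cz|apply: val_inj].
have := leq_divM n.-1 k; rewrite card_ord.
nia.
Qed.

End Turan.

(** * Positive clique density above the Turan threshold *)

Section Supersaturation.
Context {R : realFieldType}.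
Local Open Scope ring_scope.

(** By Moon-Moser, the ratio of the counts of (r+2)- and (r+1)-cliques is at least (1 - (r+1)/k +
    eta) |V|, the edge hypothesis being the case r = 0. For r < k this is at least eta |V|; multiply
    the k ratios. *)
Lemma supersaturation (V : finType) (G : graph V) (k : nat) (eta : R) :
  (0 < #|V|)%N -> (0 < k)%N -> 0 < eta ->
  (1 - k%:R^-1 + eta) * #|V|%:R ^+ 2 <= 2 * (#|edges G|)%:R ->
  eta ^+ k * #|V|%:R ^+ k.+1 <= (clique_count G k.+1)%:R.
Proof.
move=> V0 k0 eta0 hE; pose x : R := #|V|%:R; pose h r : R := (clique_count G r)%:R.
have x0 : 0 < x by rewrite ltr0n.
have kR : 0 < k%:R :> R by rewrite ltr0n.
have main r : (r < k)%N ->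
    0 < h r.+1 /\ (1 - r.+1%:R / k%:R + eta) * x * h r.+1 <= h r.+2.
  elim: r => [_|r IH rk].
    rewrite /h clique_count1 clique_count2; split=> //.
    apply: le_trans (_ : 2 * (#|edges G|)%:R <= _).
      by apply: le_trans hE; rewrite mul1r -mulrA -expr2.
    by rewrite -mul2n natrM.
  have [h1 h2] := IH (ltnW rk).
  have d0 : 0 <= 1 - r.+1%:R / k%:R :> R.
    by rewrite subr_ge0 ler_pdivrMr // mul1r ler_nat ltnW.
  have h2_gt0 : 0 < h r.+2.
    apply: lt_le_trans h2; rewrite !mulr_gt0 //; lra.
  split=> //.
  have mm : r.+2%:R * h r.+2 ^+ 2 <= h r.+1 * (x * h r.+2 + r.+1%:R * h r.+3).
    by rewrite /h /x -!natrX -!natrM -!natrD -natrM ler_nat moon_moser.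
  have key : r.+2%:R * (1 - r.+1%:R / k%:R + eta) * x * h r.+2 <=
      x * h r.+2 + r.+1%:R * h r.+3.
    rewrite -(ler_pM2l h1); apply: le_trans mm.
    rewrite expr2 [leRHS]mulrA; set a := _ + eta in h2 *.
    rewrite [leLHS](_ : _ = r.+2%:R * h r.+2 * (a * x * h r.+1)); last by ring.
    by rewrite ler_wpM2l // mulr_ge0 // ltW.
  have r1 : 0 < r.+1%:R :> R by rewrite ltr0n.
  rewrite -(ler_pM2l r1).
  apply: le_trans (_ : r.+2%:R * (1 - r.+1%:R / k%:R + eta) * x * h r.+2 - x * h r.+2 <= _);
    last by lra.
  have -> : r.+2%:R = r.+1%:R + 1 :> R by rewrite natr1.
  set p := r.+1%:R in r1 *.
  rewrite -subr_ge0.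
  rewrite (_ : _ - _ = eta * x * h r.+2); last by field; rewrite gt_eqF.
  by rewrite !mulr_ge0 // ltW.
have {}main r : (r <= k)%N -> eta ^+ r * x ^+ r.+1 <= h r.+1.
  elim: r => [_|r IH rk]; first by rewrite /h clique_count1 mul1r.
  have [h1] := main r rk; apply: le_trans.
  apply: le_trans (_ : eta * x * h r.+1 <= _).
    rewrite exprS [x ^+ _]exprS mulrACA ler_pM2l ?mulr_gt0 //.
    exact: IH (ltnW rk).
  rewrite -!mulrA; apply: ler_wpM2r; first by rewrite mulr_ge0 // ltW.
  by rewrite lerDr subr_ge0 ler_pdivrMr // mul1r ler_nat.
exact: main.
Qed.

End Supersaturation.

Local Open Scope classical_set_scope.
Local Open Scope ring_scope.

(** * Bounds on upper limits *)

Section Limsup.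
Context {R : realType}.
Implicit Types (u : nat -> \bar R) (c : R).

Lemma limn_esup_ge u c :
  (forall d N, 0 < d -> exists2 n, (N <= n)%N & ((c - d)%:E <= u n)%E) ->
  (c%:E <= limn_esup u)%E.
Proof.
move=> h; apply: le_ereal_inf_tmp => _ [A [N _ NA] <-].
apply/lee_addgt0Pr => d d0; have [n Nn un] := h d N d0.
rewrite -leeBlDr //; apply: le_trans un _.
by apply: ereal_sup_ubound; exists n => //; apply: NA.
Qed.

Lemma limn_esup_le u c :
  (forall d, 0 < d -> \forall n \near \oo, (u n <= (c + d)%:E)%E) ->
  (limn_esup u <= c%:E)%E.
Proof.
move=> h; apply/lee_addgt0Pr => d d0.
apply: le_trans (_ : ereal_sup (u @` [set n | (u n <= (c + d)%:E)%E]) <= _)%E.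
  by apply: ereal_inf_lbound; exists [set n | (u n <= (c + d)%:E)%E] => //; exact: h.
by apply: ge_ereal_sup => _ [n /= un <-].
Qed.

End Limsup.

(** * Binary logarithms and limits of powers *)

Section Log2.
Context {R : realType}.
Implicit Types (x y : R).

Let ln2_gt0 : 0 < ln 2 :> R.
Proof. by apply: ln_gt0; rewrite ltr1n. Qed.

Lemma log2K x : 0 < x -> 2 `^ log2 x = x.
Proof.
move=> x0; rewrite /powR pnatr_eq0 /= /log2 divfK ?gt_eqF //.
by apply: lnK; rewrite posrE.
Qed.

Lemma log2_ge x y : 2 `^ x <= y -> x <= log2 y.
Proof.
move=> xy; have p0 : 0 < 2 `^ x :> R by apply: powR_gt0.
rewrite /log2 ler_pdivlMr // -ln_powR ler_ln // posrE //.
exact: lt_le_trans xy.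
Qed.

Lemma log2_cvgy : (log2 n%:R : R) @[n --> \oo] --> +oo.
Proof.
apply/cvgryPge => x; near=> n; apply: log2_ge.
by near: n; exact: nbhs_infty_ger.
Unshelve. all: by end_near. Qed.

Lemma cvgy_powR (u : nat -> R) (e : R) : 0 < e ->
  u n @[n --> \oo] --> +oo -> u n `^ e @[n --> \oo] --> +oo.
Proof.
move=> e0 /cvgryPge hu; apply/cvgryPge => x; near=> n.
have [x0|x0] := leP x 0; first exact: le_trans (powR_ge0 _ _).
have <- : (x `^ e^-1) `^ e = x by rewrite -powRrM mulVf ?gt_eqF // powRr1 // ltW.
have : x `^ e^-1 <= u n by near: n; exact: hu.
move=> xu; apply: ge0_ler_powR xu; rewrite ?nnegrE ?powR_ge0 //; first exact: ltW.
by near: n; exact: hu.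
Unshelve. all: by end_near. Qed.

Lemma cvg0_exp2N (u : nat -> R) : u n @[n --> \oo] --> +oo ->
  2 `^ (- u n) @[n --> \oo] --> (0 : R).
Proof.
move=> /cvgryPge hu; apply/cvgr0Pnorm_le => e e0; near=> n.
rewrite ger0_norm ?powR_ge0 // -[leRHS]log2K //.
apply: ler_powR; first by rewrite ler1n.
by rewrite lerNl; near: n; exact: hu.
Unshelve. all: by end_near. Qed.

End Log2.

(** * Bounds on Ramsey-Turan densities *)

Section RamseyTuranDensity.
Context {R : realType}.

Lemma RT_density_ge0 (s : nat) (f : nat -> R) n :
  (0 <= RT_density (complete s) f n)%E.
Proof. by rewrite lee_fin divr_ge0. Qed.

Lemma RT_density_le (s n : nat) (f : nat -> R) (x : R) : 0 <= x ->
  (forall G : graph 'I_n, ~~ contains G (complete s) ->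
     (indep_num G)%:R < f n -> (#|edges G|)%:R <= x * n%:R ^+ 2) ->
  (RT_density (complete s) f n <= x%:E)%E.
Proof.
move=> x0 h; rewrite lee_fin.
have [->|n0] := posnP n; first by rewrite expr0n invr0 mulr0.
rewrite ler_pdivrMr ?exprn_gt0 ?ltr0n //.
(* [RT] is a maximum of natural numbers, so the real bound is rounded down first. *)
rewrite -truncn_ge_nat; last by rewrite mulr_ge0 ?exprn_ge0.
apply/bigmax_leqP => G /andP[Gs Gf].
rewrite truncn_ge_nat; last by rewrite mulr_ge0 ?exprn_ge0.
exact: h.
Qed.

Lemma rho_tau_sup_Qsucc (t k s : nat) : (2 <= t)%N -> (0 < k)%N ->
  (k * t < s)%N ->
  (((1 - k%:R^-1) / 2)%R%:E <=
    rho_tau_sup (complete s) (fun n => (Q t.+1 n)%:R : R))%E.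
Proof.
move=> t2; case: k => // -[_ _|k _ kts].
  rewrite invr1 subrr mul0r; apply: limn_esup_ge => d N d0.
  exists N => //; apply: le_trans (RT_density_ge0 _ _ _).
  by rewrite lee_fin sub0r oppr_le0 ltW.
apply: limn_esup_ge => d N d0; set K : R := k.+2%:R.
have K0 : 0 < K by rewrite ltr0n.
(* This makes n = R(t+1, m) at least [N] and d n at least 1, so that d n^2 absorbs the linear error
   term. *)
pose m := (maxn 2 (maxn N (Num.truncn (d^-1)).+1)).
have m2 : (2 <= m)%N by rewrite leq_maxl.
have [G /andP[Gs GQ] GE] := turan_ramsey_graph t2 (isT : (2 <= k.+2)%N) kts m2.
set n := ramsey t.+1 m in G Gs GQ GE *.
have mn : (m <= n)%N by apply: ramsey_ge; apply: leqW.
have Nn : (N <= n)%N by apply: leq_trans mn; rewrite !leq_max leqnn ?orbT.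
exists n => //; rewrite lee_fin.
have n0 : (0 < n)%N by lia.
have nR : 0 < n%:R :> R by rewrite ltr0n.
have dn : d^-1 <= n%:R.
  apply: le_trans (ltW (truncnS_gt _)) _; rewrite ler_nat.
  by apply: leq_trans mn; rewrite !leq_max leqnn ?orbT.
have GRT : (#|edges G|)%:R <= (RT n (complete s) ((Q t.+1 n)%:R : R))%:R :> R.
  rewrite ler_nat; apply: (@leq_bigmax_cond _ _ (fun G : graph 'I_n => #|edges G|)).
  by rewrite Gs ltr_nat.
rewrite ler_pdivlMr ?exprn_gt0 //; apply: le_trans GRT.
move: GE; rewrite -(ler_nat R) -mulnn -muln2 !(natrM, natrD) -/K.
set E : R := (#|edges G|)%:R; set x : R := n%:R in nR dn * => GE.
have dx : 1 <= d * x by rewrite mulrC -ler_pdivrMr // mul1r.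
rewrite -(ler_pM2l K0).
have -> : K * (((1 - K^-1) / 2 - d) * x ^+ 2) = (K * x ^+ 2 - x ^+ 2) / 2 - K * x * (d * x).
  by field; rewrite gt_eqF.
have : K * x * 1 <= K * x * (d * x) by rewrite ler_pM2l // mulr_gt0.
have : 0 <= K * x by rewrite mulr_ge0 // ltW.
by move: GE; rewrite expr2; lra.
Qed.

(** For X near (log n)^(1/(3r)), the factor 2^(X^(3r-1)) in [many_cliques_contains] is governed by
    (log n)^(1 - 1/(3r)). *)
Definition drc_exponent (r : nat) : R := (3 * r)%:R^-1.

Lemma dense_contains (t r B X n : nat) (G : graph 'I_n) (eta : R) :
  (2 <= t)%N -> (1 < r)%N -> (0 < n)%N -> 0 < eta ->
  (indep_num G * 2 ^ (X ^ (3 * r).-1) < Q t n)%N ->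
  (n <= 2 ^ (B * X ^ (3 * r)))%N -> (B * t + 3 <= X)%N ->
  (2 ^+ X)^-1 <= eta ^+ r.-1 ->
  (1 - r.-1%:R^-1 + eta) * n%:R ^+ 2 <= 2 * (#|edges G|)%:R ->
  contains G (complete (r * t)).
Proof.
move=> t2 r1 n0 eta0 GQ nB BX Xeta GE.
apply: (@many_cliques_contains _ G t r B X); rewrite ?card_ord //.
- exact: ltnW.
- by move=> S hS; apply: clique_of_indep_num_lt_Q GQ hS.
have := @supersaturation R _ G r.-1 eta; rewrite card_ord n0 -subn1 subn_gt0 r1.
rewrite subn1 => /(_ isT isT eta0 GE); rewrite prednK; last exact: ltnW.
move=> h; rewrite -(ler_nat R) natrM !natrX.
rewrite -ler_pdivrMl ?exprn_gt0 //; apply: le_trans h.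
by apply: ler_wpM2r => //; apply: exprn_ge0.
Qed.

Lemma rho_tau_sup_le (t k s : nat) (phi : nat -> R) :
  (2 <= t)%N -> (0 < k)%N -> (s <= k.+1 * t)%N ->
  (\forall n \near \oo,
     phi n <= 2 `^ (- (log2 n%:R `^ (1 - drc_exponent k.+1)))) ->
  (rho_tau_sup (complete s) (fun n => phi n * (Q t n)%:R)%R <=
    ((1 - k%:R^-1) / 2)%R%:E)%E.
Proof.
move=> t2 k0 skt hphi; apply: limn_esup_le => d d0.
set p := (3 * k.+1)%N; have p0 : (0 < p)%N by [].
have pR : 0 < p%:R :> R by rewrite ltr0n.
(* From [y <= 2 * X], log n = y^p <= 2^p X^p, whence [B]. The 2 in [eta] comes from counting each
   edge twice. *)
pose B := (2 ^ p)%N; pose eta := 2 * d; have eta0 : 0 < eta by rewrite mulr_gt0.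
pose K := maxn (B * t + 3) (Num.truncn ((eta ^+ k)^-1)).+1.
near=> n.
have n0 : (0 < n)%N by near: n; exact: nbhs_infty_gt.
have nR : 0 < n%:R :> R by rewrite ltr0n.
have LK : K%:R ^+ p <= log2 (n%:R : R).
  by near: n; exact: ((cvgryPge _).1 log2_cvgy).
have phin : phi n <= 2 `^ (- (log2 n%:R `^ (1 - p%:R^-1))) by near: n.
set L := log2 (n%:R : R) in LK phin.
have L0 : 0 <= L by apply: le_trans LK; rewrite exprn_ge0.
pose y := L `^ p%:R^-1; pose X := Num.truncn y.
have y0 : 0 <= y by apply: powR_ge0.
have yp : y ^+ p = L.
  by rewrite -powR_mulrn // -powRrM mulVf ?gt_eqF // powRr1.
have KX : (K <= X)%N.
  rewrite truncn_ge_nat // leNgt; apply/negP => yK.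
  have : y ^+ p < K%:R ^+ p by rewrite ltr_pXn2r // nnegrE.
  by rewrite yp ltNge LK.
have X0 : (0 < X)%N by apply: leq_trans KX; rewrite /K; lia.
have Xy : X%:R <= y by rewrite truncn_le.
have yX : y <= (2 * X)%:R.
  by apply: le_trans (ltW (truncnS_gt _)) _; rewrite ler_nat -/X; lia.
apply: RT_density_le.
  rewrite addr_ge0 ?(ltW d0) // divr_ge0 // subr_ge0 invf_le1 ?ltr0n //.
  by rewrite ler1n.
move=> G Gs GQ; rewrite leNgt; apply/negP => GE.
move/negP: Gs; apply; apply: contains_complete_leq skt _.
apply: (@dense_contains t k.+1 B X n G eta) => //.
(* (log n)^(1 - 1/p) is y^(p-1), which is at least X^(p-1). *)
- have : (indep_num G)%:R < (2 ^+ (X ^ p.-1))^-1 * (Q t n)%:R :> R.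
    apply: lt_le_trans GQ _; apply: ler_wpM2r => //; apply: le_trans phin _.
    rewrite powRN lef_pV2 ?posrE ?exprn_gt0 ?powR_gt0 //.
    rewrite -powR_mulrn //; apply: ler_powR; first by rewrite ler1n.
    have -> : L `^ (1 - p%:R^-1) = y ^+ p.-1.
      rewrite -powR_mulrn // -powRrM; congr (_ `^ _).
      by rewrite -subn1 natrB // mulrBr mulVf ?gt_eqF // mulr1.
    by rewrite natrX lerXn2r // nnegrE.
  rewrite ltr_pdivlMl ?exprn_gt0 // mulrC.
  by rewrite -natrX -natrM ltr_nat.
- rewrite -(ler_nat R) -[leLHS]log2K // natrX -powR_mulrn //.
  apply: ler_powR; first by rewrite ler1n.
  rewrite -/L -yp natrM /B -natrM -expnMn natrX lerXn2r // nnegrE //.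
- by apply: leq_trans KX; rewrite leq_maxl.
- rewrite invf_ple ?posrE ?exprn_gt0 //.
  apply: le_trans (ltW (truncnS_gt _)) _; rewrite -natrX ler_nat.
  apply: leq_trans (_ : X <= _)%N; first by apply: leq_trans KX; rewrite leq_maxr.
  by apply: ltnW; apply: ltn_expl.
move: GE; rewrite /eta /= => /ltW GE.
by have := GE; set a := _^-1; set x := _ ^+ 2; set E := _%:R; lra.
Unshelve. all: by end_near. Qed.

(** A K_s-free graph is then K_t-free, so none has independence number below Q(t,n) and the maximum
    is empty. *)
Lemma rho_tau_inf_Q_small (t s : nat) : (2 <= t)%N -> (s <= t)%N ->
  (rho_tau_inf (complete s) (fun n => (Q t n)%:R : R) <= 0)%E.
Proof.
move=> t2 st; apply: le_trans (limn_einf_sup _) _.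
apply: limn_esup_le => d d0; apply: nearW => n; rewrite add0r.
apply: RT_density_le => [|G Gs]; first exact: ltW.
rewrite ltr_nat ltnNge Q_le //.
by apply: contra Gs; apply: contains_complete_leq.
Qed.

End RamseyTuranDensity.

(** * Comparison of the two density bounds *)

Theorem theorem3p11 (R : realType) (t s : nat) (ht : (2 <= t)%N) (hs : (2 <= s)%N)
  (hR : exists theta : R, 0 < theta /\ exists N : nat, (0 < N)%N /\
     forall n : nat, (N < n)%N ->
       (ramsey t n)%:R <= (ramsey t.+1 n)%:R / n%:R `^ theta)
  (hQ : phase_transition (complete s)
          (fun n => (Q t n)%:R : R) (fun n => (Q t.+1 n)%:R : R)) :
  exists eps : R, 0 < eps /\
    forall omega : nat -> R, slowly_to_infinity omega ->
      (phi_phase_transition (complete s) (phi_eps eps omega)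
         (fun n => (Q t n)%:R) /\
       weak_phase_transition (complete s) (fun n => (Q t n)%:R : R)) /\
      ~ phase_transition (complete s)
          (fun n => phi_eps eps omega n * (Q t n)%:R)
          (fun n => (Q t.+1 n)%:R).
Proof.
pose k := (s.-1 %/ t)%N.
have t0 : (0 < t)%N by apply: ltnW.
have k0 : (0 < k)%N.
  (* If s <= t, [hQ] would put a nonnegative upper density strictly below 0. *)
  rewrite divn_gt0 // leqNgt; apply/negP => st.
  have /(rho_tau_inf_Q_small (R := R) ht) : (s <= t)%N by lia.
  move=> /(lt_le_trans hQ); rewrite ltNge => /negP; apply.
  apply: limn_esup_ge => d N d0; exists N => //.
  by apply: le_trans (RT_density_ge0 _ _ _); rewrite lee_fin sub0r oppr_le0 ltW.
have kts : (k * t < s)%N by have := leq_divM s.-1 t; rewrite -/k; lia.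
have skt : (s <= k.+1 * t)%N by have := ltn_ceil s.-1 t0; rewrite -/k; lia.
pose eps : R := drc_exponent k.+1; exists eps.
have eps0 : 0 < eps by rewrite invr_gt0 ltr0n.
have eps1 : 0 < 1 - eps.
  by rewrite subr_gt0 invf_lt1 ?ltr0n // ltr1n; lia.
have y_cvg : (log2 n%:R : R) `^ (1 - eps) @[n --> \oo] --> +oo.
  by apply: cvgy_powR eps1 _; exact: log2_cvgy.
(* Stated for any eventually small [phi], to serve both with and without the factor [omega]. *)
have upper (phi : nat -> R) :
    (\forall n \near \oo, phi n <= 2 `^ (- (log2 n%:R `^ (1 - eps)))) ->
    (rho_tau_sup (complete s) (fun n => phi n * (Q t n)%:R)%R <=
     rho_tau_sup (complete s) (fun n => (Q t.+1 n)%:R : R))%E.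
  move=> /(rho_tau_sup_le ht k0 skt)/le_trans; apply.
  exact: rho_tau_sup_Qsucc.
split=> // omega [/cvgryPge omega_cvg _].
have phi_le : \forall n \near \oo,
    phi_eps eps omega n <= 2 `^ (- (log2 n%:R `^ (1 - eps))).
  near=> n; apply: ler_powR; first by rewrite ler1n.
  rewrite lerN2 ler_peMl ?powR_ge0 //.
  by near: n; exact: omega_cvg.
split; first split.
- split; last exact: le_lt_trans (upper _ phi_le) hQ.
  apply: cvg0_exp2N; apply/cvgryPge => x; near=> n.
  apply: le_trans (_ : log2 n%:R `^ (1 - eps) <= _).
    by near: n; move/cvgryPge: y_cvg; apply.
  by rewrite ler_peMl ?powR_ge0 //; near: n; exact: omega_cvg.
- exists eps => //; split; first exact: cvg0_exp2N.
  apply: le_lt_trans (upper _ _) hQ; exact: nearW.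
(* A transition would put the upper density for Q(t+1,n) below the lower, hence the upper, density
   for the scaled Q(t,n), against [upper]. *)
- rewrite /phase_transition => /lt_le_trans/(_ (limn_einf_sup _)).
  by rewrite ltNge upper.
Unshelve. all: by end_near. Qed.
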